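(* For all integers $n \geq 0$ we have $g_n = \sum_{1 \leq i \leq n} k_i$.
   Context: Gutkovskiy's sequence $(g_n)_{n\ge 0}$ is defined by $g_0 = 0$ and $g_n = n - g_{\lfloor g_{n-1}/2 \rfloor}$ for $n \geq 1$. Let $h$ be the morphism on binary words given by $h(1) = 110$ and $h(0) = 11$. The infinite word $\mathbf{k} = k_1 k_2 k_3 \cdots = 1101101111\cdots$ (indexed starting from $1$) is the infinite fixed point of $h$, i.e., the unique infinite word having every $h^n(1)$, $n\ge 0$, as a prefix. Its letters $k_i \in \{0,1\}$ are regarded as integers. *)

(* Defs.v *)
From mathcomp Require Import all_boot.

Set Implicit Arguments.
Unset Strict Implicit.
Unset Printing Implicit Defensive.

(* The recurrence refers back to an index that depends on the previous value,
   so it is run on the whole history [:: g_0; ...; g_n].  The subtraction on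
   nat never truncates: see g_rec_le. *)
Fixpoint g_history (n : nat) : seq nat :=
  if n is m.+1 then
    let s := g_history m in rcons s (m.+1 - nth 0 s (last 0 s)./2)
  else [:: 0].

Definition g (n : nat) : nat := last 0 (g_history n).

Lemma size_g_history n : size (g_history n) = n.+1.
Proof. by elim: n => //= n IHn; rewrite size_rcons IHn. Qed.

Lemma nth_g_history n i : i <= n -> nth 0 (g_history n) i = g i.
Proof.
elim: n => [|n IHn]; first by rewrite leqn0 => /eqP->.
rewrite leq_eqVlt => /predU1P[-> | lt_i_n].
  by rewrite /g (last_nth 0) size_g_history.
by rewrite /= nth_rcons size_g_history lt_i_n IHn.
Qed.

Lemma g_le n : g n <= n.
Proof. by case: n => // n; rewrite /g /= last_rcons leq_subr. Qed.

Lemma half_g_le n : (g n)./2 <= n.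
Proof.
rewrite leq_half_double; apply: leq_trans (g_le n) _.
by rewrite -addnn -addnS leq_addr.
Qed.

Lemma g0 : g 0 = 0.
Proof. by []. Qed.

Lemma gE n : 1 <= n -> g n = n - g (g n.-1)./2.
Proof.
case: n => // n _.
by rewrite {1}/g /= last_rcons nth_g_history ?half_g_le.
Qed.

Lemma g_rec_le n : g (g n.-1)./2 <= n.
Proof.
exact: leq_trans (g_le _) (leq_trans (half_g_le _) (leq_pred n)).
Qed.

(* Binary words are bitseqs, with true for the letter 1 and false for 0. *)
Definition h_letter (b : bool) : bitseq :=
  if b then [:: true; true; false] else [:: true; true].

Definition h (w : bitseq) : bitseq := flatten (map h_letter w).

Definition h_iter (n : nat) : bitseq := iter n h [:: true].

(* Indexed from 1, the value k 0 being irrelevant.  The word h^i(1) has more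
   than i letters, so the default value of nth is never used. *)
Definition k (i : nat) : bool := nth false (h_iter i) i.-1.

Lemma h_cat u v : h (u ++ v) = h u ++ h v.
Proof. by rewrite /h map_cat flatten_cat. Qed.

Lemma h_prefix u v : prefix u v -> prefix (h u) (h v).
Proof. by case/prefixP=> w ->; rewrite h_cat prefix_prefix. Qed.

Lemma h_iter_prefix m n : m <= n -> prefix (h_iter m) (h_iter n).
Proof.
have step p : prefix (h_iter p) (h_iter p.+1).
  by elim: p => // p; apply: h_prefix.
elim: n => [|n IHn]; first by rewrite leqn0 => /eqP->.
rewrite leq_eqVlt => /predU1P[-> | /IHn le_mn]; first exact: prefix_refl.
exact: prefix_trans le_mn (step n).
Qed.

Lemma size_h w : size w + size w <= size (h w).
Proof.
elim: w => // b w IHw; rewrite [h _]/(h_letter b ++ h w) size_cat /= addnS addSn.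
by apply: (@leq_add 2 _ _ _ _ IHw); case: b.
Qed.

Lemma size_h_iter n : n < size (h_iter n).
Proof.
elim: n => // n IHn; apply: leq_trans (size_h _).
rewrite -[n.+2]addn1; exact: leq_add IHn (leq_ltn_trans (leq0n n) IHn).
Qed.

Lemma nth_h_iter m n i : i < size (h_iter m) -> m <= n ->
  nth false (h_iter n) i = nth false (h_iter m) i.
Proof. by move=> lt_i /h_iter_prefix/prefixP[w ->]; rewrite nth_cat lt_i. Qed.

Definition has_all_h_iter_prefixes (w : nat -> bool) : Prop :=
  forall n i : nat, 1 <= i <= size (h_iter n) -> w i = nth false (h_iter n) i.-1.

Lemma k_prefixes : has_all_h_iter_prefixes k.
Proof.
move=> n [|i] // /andP[_ lt_i]; rewrite /k.
have [le_ni | /ltnW le_in] := leqP n i.+1; first exact: (nth_h_iter lt_i le_ni).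
by apply/esym/(nth_h_iter _ le_in)/ltnW/size_h_iter.
Qed.

Lemma k_unique (w : nat -> bool) : has_all_h_iter_prefixes w ->
  forall i : nat, 1 <= i -> w i = k i.
Proof. by move=> Hw i i_gt0; rewrite (Hw i) // i_gt0 ltnW // size_h_iter. Qed.

(* Main.v *)
(* Since k = h(k), the word k is the concatenation of the blocks h(k_1), h(k_2),
   ..., each holding two 1's, followed by a 0 exactly when k_i = 1.  So the first
   n letters hold S_j = k_1 + ... + k_j zeros, where j is the number of blocks
   whose two 1's precede position n, that is j = floor(S_(n-1)/2).  Hence
   n - S_n = S_(floor(S_(n-1)/2)), which is the recurrence of g. *)
Require Import Defs.
From mathcomp Require Import all_boot.

(** Induction on [w], block by block: each block holds exactly two 1's, so removing it lowers the
    halved count by one, just as [w] loses one letter. *)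
Lemma count_negb_take_h (w : bitseq) (n : nat) : 0 < n <= size (h w) ->
  count negb (take n (h w)) =
  count id (take (count id (take n.-1 (h w)))./2 w).
Proof.
elim: w n => [|b w IHw] n; first by case: n.
rewrite [h (b :: w)]/(h_letter b ++ h w).
case: b => /=.
  case: n => [|[|[|[|n]]]] //=; rewrite ?take0 // !ltnS => le_n.
  by rewrite (IHw n.+1).
case: n => [|[|[|n]]] //=; rewrite ?take0 // !ltnS => le_n.
by rewrite (IHw n.+1).
Qed.

Lemma sum_k_take (m n : nat) : n <= size (h_iter m) ->
  \sum_(1 <= i < n.+1) k i = count id (take n (h_iter m)).
Proof.
elim: n => [|n IHn] lt_n; first by rewrite big_geq // take0.
rewrite big_nat_recr //= IHn ?(ltnW lt_n) // (@k_prefixes m) //.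
by rewrite (take_nth false) // -cats1 count_cat /= addn0.
Qed.

Theorem theorem2 (n : nat) : g n = \sum_(1 <= i < n.+1) nat_of_bool (k i).
Proof.
have [m] := ubnP n; elim: m n => // m IHm [|n]; first by rewrite big_geq.
rewrite ltnS => lt_nm; have lt_n := size_h_iter n.
have lt_n1 : n.+1 <= size (h_iter n.+1) by apply/ltnW/size_h_iter.
(* Puts the inner index within reach of [IHm] and of the letters of [h_iter n]. *)
have le_half : (\sum_(1 <= i < n.+1) k i)./2 <= n by rewrite -IHm ?half_g_le.
rewrite gE //= !IHm ?(leq_ltn_trans le_half) //.
(* The inner sum is read in [h_iter n], the other two in its image [h_iter n.+1], to fit
   [count_negb_take_h]. *)
rewrite (@sum_k_take n _ (leq_trans le_half (ltnW lt_n))).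
rewrite !(@sum_k_take n.+1) // ?(ltnW lt_n1) //.
rewrite -(count_negb_take_h (h_iter n) n.+1) //.
rewrite -[X in X - _](size_takel lt_n1) -(count_predC id).
exact: addnK.
Qed.
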